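(* Let $n\ge 1$. For every partition $\lambda$ of $n$, the map $f:S_n\to S_n$ has exactly one fixed point $\pi$ of shape $\lambda$, i.e. exactly one permutation $\pi\in S_n$ with $f(\pi)=\pi$ such that the two tableaux in $\mathrm{RSK}(\pi)$ have shape $\lambda$.
   Context: $S_n$ is the set of permutations of $1,2,\ldots,n$, written as words $\pi=\pi_1,\ldots,\pi_n$. A Young diagram of a partition $\lambda=(\lambda_1\ge\cdots\ge\lambda_k>0)$ of $n$ is drawn in French notation: left-justified rows, with $\lambda_i$ boxes in the $i$-th row from the bottom. A standard Young tableau (SYT) of shape $\lambda$ is a filling of the boxes with $1,\ldots,n$, each used once, with rows increasing left to right and columns increasing bottom to top. RSK: for $\pi\in S_n$, $\mathrm{RSK}(\pi)=(S,T)$, where $S$ (the insertion tableau) is obtained by starting from the empty tableau and inserting $\pi_1,\pi_2,\ldots,\pi_n$ in order. To insert $a$ into a row (starting with the bottom row): if $a$ is larger than every entry of the row, place $a$ at the end of the row and stop; otherwise $a$ replaces the leftmost entry $b$ of the row that is greater than $a$, and $b$ is then inserted into the next row up by the same rule. The recording tableau $T$ has the same shape as $S$, with the box that is newly created when inserting $\pi_i$ labeled $i$. RSK is a bijection from $S_n$ to pairs of SYT of size $n$ of the same shape. The reading word of an SYT is the permutation obtained by concatenating its rows from the top row to the bottom row, each read left to right. The map $f:S_n\to S_n$ is defined by: if $\mathrm{RSK}(\pi)=(S,T)$, then $f(\pi)$ is the reading word of $T$. *)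

(* Defs.v *)
From mathcomp Require Import all_boot all_fingroup.

Set Implicit Arguments.
Unset Strict Implicit.
Unset Printing Implicit Defensive.

Definition is_partition (n : nat) (la : seq nat) : bool :=
  [&& sorted geq la, all (ltn 0) la & sumn la == n].

(* A filling is the list of its rows from bottom to top (French notation), so
   that the library's [shape] returns the row lengths lambda_1, lambda_2, ... *)
Definition filling := seq (seq nat).

(* The second component is the index (0 = bottom) of the row at the end of which
   the new box has been created. *)
Fixpoint insert (t : filling) (a : nat) : filling * nat :=
  if t is r :: t' then
    if all (gtn a) r then (rcons r a :: t', 0)
    else
      let k := find (ltn a) r in
      let: (t'', i) := insert t' (nth 0 r k) in
      (set_nth 0 r k a :: t'', i.+1)
  else ([:: [:: a]], 0).

Definition add_box (t : filling) (i m : nat) : filling :=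
  set_nth [::] t i (rcons (nth [::] t i) m).

Definition rsk_step (ST : filling * filling) (am : nat * nat) :
    filling * filling :=
  let: (S', i) := insert ST.1 am.1 in (S', add_box ST.2 i am.2).

Definition rsk_word (w : seq nat) : filling * filling :=
  foldl rsk_step ([::], [::]) (zip w (iota 1 (size w))).

Definition reading_word (t : filling) : seq nat := flatten (rev t).

(* One-line notation. 'S_n permutes {0, ..., n - 1}, whence the shift by one. *)
Definition word n (s : 'S_n) : seq nat := [seq (s i).+1 | i <- enum 'I_n].

Definition RSK n (s : 'S_n) : filling * filling := rsk_word (word s).

Lemma size_perm_word n w : perm_eq w (iota 1 n) -> size w = n.
Proof. by move=> /perm_size ->; rewrite size_iota. Qed.

Lemma nth_perm_word n w (i : 'I_n) :
  perm_eq w (iota 1 n) -> 0 < nth 0 w i <= n.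
Proof.
move=> w_perm; have : nth 0 w i \in w by rewrite mem_nth // (size_perm_word w_perm).
by rewrite (perm_mem w_perm) mem_iota add1n ltnS.
Qed.

Lemma letter_subproof n w (w_perm : perm_eq w (iota 1 n)) (i : 'I_n) :
  (nth 0 w i).-1 < n.
Proof. by have /andP[h] := nth_perm_word i w_perm; rewrite -[X in X <= n](prednK h). Qed.

Definition letter n w (w_perm : perm_eq w (iota 1 n)) (i : 'I_n) : 'I_n :=
  Ordinal (letter_subproof w_perm i).

Lemma letter_inj n w (w_perm : perm_eq w (iota 1 n)) : injective (letter w_perm).
Proof.
move=> i j /(congr1 val) /= eq_ij; apply: val_inj; apply/eqP.
have w_uniq : uniq w by rewrite (perm_uniq w_perm) iota_uniq.
rewrite -(nth_uniq 0 _ _ w_uniq) ?(size_perm_word w_perm) ?ltn_ord //.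
have /andP[hi _] := nth_perm_word i w_perm.
have /andP[hj _] := nth_perm_word j w_perm.
by rewrite -(prednK hi) -(prednK hj) eq_ij.
Qed.

Definition perm_of_word n w (w_perm : perm_eq w (iota 1 n)) : 'S_n :=
  perm (letter_inj (w_perm := w_perm)).

Lemma word_perm_of_word n w (w_perm : perm_eq w (iota 1 n)) :
  word (perm_of_word w_perm) = w.
Proof.
apply: (@eq_from_nth _ 0) => [|i]; rewrite size_map size_enum_ord.
  by rewrite (size_perm_word w_perm).
move=> lt_in; rewrite (nth_map (Ordinal lt_in)) ?size_enum_ord //.
rewrite permE /= nth_enum_ord //.
by have /andP[h _] := nth_perm_word (Ordinal lt_in) w_perm; rewrite prednK.
Qed.

Lemma word_perm_eq n (s : 'S_n) : perm_eq (word s) (iota 1 n).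
Proof.
rewrite (_ : iota 1 n = [seq (val i).+1 | i <- enum 'I_n]); last first.
  by rewrite (map_comp succn val) val_enum_ord -(iotaDl 1).
rewrite /word (map_comp (fun i : 'I_n => (val i).+1) s); apply: perm_map.
apply: uniq_perm => [||i]; rewrite ?(map_inj_uniq perm_inj) ?enum_uniq //.
rewrite mem_enum; apply/mapP; exists ((s^-1)%g i); rewrite ?mem_enum //.
by rewrite permKV.
Qed.

Lemma perm_add_box t i m : perm_eq (flatten (add_box t i m)) (m :: flatten t).
Proof.
rewrite /add_box; elim: t i => [|r t IHt] [|i] //=.
- by elim: i => //= i; rewrite !nth_nil.
- by rewrite cat_rcons perm_catC /= perm_cons perm_catC.
- apply: (perm_trans (y := r ++ m :: flatten t)); first by rewrite perm_cat2l.
  by rewrite -cat1s perm_catCA.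
Qed.

Lemma perm_recording w :
  perm_eq (flatten (rsk_word w).2) (iota 1 (size w)).
Proof.
have aux : forall (u : seq (nat * nat)) ST,
    perm_eq (flatten (foldl rsk_step ST u).2) (flatten ST.2 ++ unzip2 u).
  elim=> [|[a m] u IHu] ST /=; first by rewrite cats0.
  apply: (perm_trans (IHu _)); rewrite /rsk_step /=.
  case: (insert _ _) => S' i /=.
  rewrite -cat_rcons perm_cat2r (perm_trans (perm_add_box _ _ _)) //.
  by rewrite perm_sym perm_rcons.
by have := aux (zip w (iota 1 (size w))) ([::], [::]); rewrite unzip2_zip ?size_iota.
Qed.

Lemma reading_recording_perm n (s : 'S_n) :
  perm_eq (reading_word (RSK s).2) (iota 1 n).
Proof.
have sz : size (word s) = n by rewrite size_map size_enum_ord.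
rewrite -[X in iota 1 X]sz.
apply: perm_trans (perm_recording (word s)).
by apply: perm_flatten; rewrite perm_rev.
Qed.

Definition f n (s : 'S_n) : 'S_n := perm_of_word (reading_recording_perm s).

Lemma word_f n (s : 'S_n) : word (f s) = reading_word (RSK s).2.
Proof. exact: word_perm_of_word. Qed.

(* Main.v *)
(* For a standard tableau T, inserting the reading word of T rebuilds T, and the
   recording tableau obtained on the way depends only on the shape of T: when a
   row r is inserted into a tableau with bottom row u lying above r, the letters
   of u are bumped out one by one, from left to right, and are in turn inserted
   into the rows above u.  Hence RSK (reading word of T) = (T, Q) with
   Q = Q_lambda.  A fixed point of shape lambda is the reading word of its own
   recording tableau T, so T = Q_lambda; conversely, as Q_lambda is itself a
   standard tableau of shape lambda, its reading word is a fixed point. *)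
Require Import Defs.
From mathcomp Require Import all_boot all_fingroup.

Set Implicit Arguments.
Unset Strict Implicit.
Unset Printing Implicit Defensive.

(** * Column condition between adjacent rows, and tableaux *)

Definition dominates (u r : seq nat) : bool :=
  (size u <= size r) && all (fun p => p.1 < p.2) (zip r u).

Lemma dominatesP u r :
  reflect (size u <= size r /\ forall j, j < size u -> nth 0 r j < nth 0 u j)
          (dominates u r).
Proof.
apply: (iffP andP) => -[le_ur h]; split=> //.
  move=> j lt_ju; move/(all_nthP (0, 0)): h => /(_ j).
  by rewrite size_zip (minn_idPr le_ur) nth_zip_cond size_zip (minn_idPr le_ur) lt_ju => /(_ isT).
apply/(all_nthP (0, 0)) => j; rewrite size_zip (minn_idPr le_ur) => lt_ju.
by rewrite nth_zip_cond size_zip (minn_idPr le_ur) lt_ju; apply: h.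
Qed.

Lemma dominates_rcons u r m : dominates u r -> dominates u (rcons r m).
Proof.
move=> /dominatesP[le_ur dom]; apply/dominatesP; rewrite size_rcons leqW //.
by split=> // j lt_j; rewrite nth_rcons (leq_trans lt_j) ?dom.
Qed.

Lemma dominates0 r : dominates [::] r.
Proof. by apply/dominatesP; split. Qed.

(** The entries need not be 1, ..., n, since insertion passes through tableaux on arbitrary letters.
    The top row is compared with the empty default row, which dominates every row. *)
Fixpoint tableau (t : filling) : bool :=
  if t is r :: t' then
    [&& r != [::], sorted ltn r, dominates (head [::] t') r & tableau t']
  else true.

Lemma tableau_shape_sorted t : tableau t -> sorted geq (shape t).
Proof.
elim: t => //= r [|u t] //= IHt /and4P[_ _ /andP[le_ur _] tab_t].
by rewrite le_ur IHt.
Qed.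

(** * Insertion of the reading word of a tableau *)

(** Insertion never consults the recording tableau, so it suffices to keep the row indices of the
    new boxes and to let [record] place the labels afterwards. *)
Fixpoint insert_word (t : filling) (w : seq nat) : filling * seq nat :=
  if w is a :: w' then
    let ti := insert t a in let tis := insert_word ti.1 w' in
    (tis.1, ti.2 :: tis.2)
  else (t, [::]).

Definition record (t : filling) (bs : seq nat) (ms : seq nat) : filling :=
  foldl (fun t' p => add_box t' p.1 p.2) t (zip bs ms).

Lemma foldl_rsk_step w ms S T :
  size w = size ms ->
  foldl rsk_step (S, T) (zip w ms) =
    ((insert_word S w).1, record T (insert_word S w).2 ms).
Proof.
elim: w ms S T => [|a w IHw] [|m ms] S T //= [eq_sz].
by rewrite /rsk_step /=; case: (insert S a) => S' i /=; rewrite IHw.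
Qed.

Lemma rsk_wordE w :
  rsk_word w = ((insert_word [::] w).1,
                record [::] (insert_word [::] w).2 (iota 1 (size w))).
Proof. by rewrite -foldl_rsk_step ?size_iota. Qed.

Lemma insert_word_cat t w1 w2 :
  insert_word t (w1 ++ w2) =
    ((insert_word (insert_word t w1).1 w2).1,
     (insert_word t w1).2 ++ (insert_word (insert_word t w1).1 w2).2).
Proof.
by elim: w1 t => [|a w1 IH] t //=; rewrite ?IH //; case: insert_word.
Qed.

(* The letters [p] have already replaced the beginning of the bottom row, of
   which [v] is what remains to be bumped out by [w]. *)
Lemma insert_word_bottom p v t w :
  sorted ltn (p ++ w) -> dominates v w ->
  insert_word ((p ++ v) :: t) w =
    ((p ++ w) :: (insert_word t v).1,
     map succn (insert_word t v).2 ++ nseq (size w - size v) 0).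
Proof.
elim: w p v t => [|a w IHw] p v t srt; first by case: v.
have lt_pa : all (gtn a) p.
  move: srt; rewrite (sorted_pairwise ltn_trans) pairwise_cat => /and3P[+ _ _].
  by move=> /allrelP h; apply/allP => x px; apply: (h x a px); rewrite mem_head.
rewrite -cat_rcons in srt.
case: v => [_|b v /andP[/= le_vw /andP[lt_ab dom_vw]]] /=.
  rewrite cats0 lt_pa /=.
  by have := IHw (rcons p a) [::] t srt (dominates0 _); rewrite cats0 cat_rcons subn0 => ->.
(* Dominance gives [a < b], while all of [p] is below [a]: the letter bumped out is exactly [b]. *)
have -> : all (gtn a) (p ++ b :: v) = false.
  by rewrite all_cat /= ltnNge (ltnW lt_ab) andbF.
have -> : find (ltn a) (p ++ b :: v) = size p.
  rewrite find_cat /= lt_ab addn0; case: hasP => // -[x px /= lt_ax].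
  by have /= := allP lt_pa x px; rewrite ltnNge (ltnW lt_ax).
rewrite nth_cat ltnn subnn /=.
case: (insert t b) => t1 i /=.
have -> : set_nth 0 (p ++ b :: v) (size p) a = rcons p a ++ v.
  by rewrite cat_rcons; elim: (p) => //= x q ->.
by rewrite IHw ?srt //; [rewrite cat_rcons | apply/andP].
Qed.

(** Rows of the boxes created by inserting a row of length [m] that slides under a tableau of shape
    [la]: the displaced bottom row acts one level up, then the surplus letters are appended. *)
Fixpoint row_boxes (m : nat) (la : seq nat) : seq nat :=
  if la is l :: la' then map succn (row_boxes l la') ++ nseq (m - l) 0
  else nseq m 0.

Lemma insert_word_row r t :
  tableau (r :: t) ->
  insert_word t r = (r :: t, row_boxes (size r) (shape t)).
Proof.
elim: t r => [|u t IHt] r /and4P[r_neq0 srt dom tab] /=.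
  (* In the empty tableau the first letter opens the bottom row, whence the prefix [[:: a]]
     below. *)
  case: r r_neq0 srt {dom} => //= a r _ srt.
  by have /= := @insert_word_bottom [:: a] [::] [::] r srt (dominates0 _); rewrite subn0 => ->.
by have /= := @insert_word_bottom [::] u t r srt dom; rewrite IHt.
Qed.

Fixpoint shape_boxes (la : seq nat) : seq nat :=
  if la is l :: la' then shape_boxes la' ++ row_boxes l la' else [::].

Lemma insert_reading_word t :
  tableau t -> insert_word [::] (reading_word t) = (t, shape_boxes (shape t)).
Proof.
rewrite /reading_word; elim: t => [|r t IHt] // tab_rt.
have /and4P[_ _ _ tab_t] := tab_rt.
by rewrite rev_cons flatten_rcons insert_word_cat IHt //= insert_word_row.
Qed.

(** This is Q_lambda. That its shape is [la] is only deduced in the final proof, from a permutation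
    of which it is the recording tableau. *)
Definition shape_recording (la : seq nat) : filling :=
  record [::] (shape_boxes la) (iota 1 (sumn la)).

Lemma rsk_reading_word t :
  tableau t -> rsk_word (reading_word t) = (t, shape_recording (shape t)).
Proof.
move=> tab_t; rewrite rsk_wordE insert_reading_word // /shape_recording.
by rewrite /reading_word size_flatten /shape map_rev sumn_rev.
Qed.

(** * Recording tableaux are standard *)

Lemma perm_set_nth r k a :
  k < size r -> perm_eq (nth 0 r k :: set_nth 0 r k a) (a :: r).
Proof.
elim: r k => [|x r IHr] [|k] //= lt_kr.
  by apply/seq.permP => P /=; rewrite addnCA.
have /seq.permP h := IHr k lt_kr; apply/seq.permP => P /=.
by rewrite addnCA -/(count _ (_ :: _)); have /= -> := h P; rewrite addnCA.
Qed.

(** Covers bumping and appending at once: if no entry exceeds [a], [find] returns [size r] and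
    [set_nth] lengthens the row. *)
Definition row_insert (r : seq nat) (a : nat) : seq nat :=
  set_nth 0 r (find (ltn a) r) a.

Lemma find_ltn_size r a : a \notin r -> ~~ all (gtn a) r -> find (ltn a) r < size r.
Proof.
move=> a_r; rewrite -has_find -has_predC => /hasP[x xr /= nlt_xa].
apply/hasP; exists x => //=; rewrite ltn_neqAle leqNgt nlt_xa andbT.
by apply: contraNneq a_r => ->.
Qed.

Lemma row_insert_rcons r a : all (gtn a) r -> row_insert r a = rcons r a.
Proof.
rewrite /row_insert; elim: r => //= x r IHr /andP[lt_xa /IHr].
by rewrite ltnNge (ltnW lt_xa) /= => ->.
Qed.

Lemma head_insert t a :
  head [::] (insert t a).1 = row_insert (head [::] t) a.
Proof.
case: t => //= r t; case: ifP => [/row_insert_rcons -> //|_].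
by case: insert.
Qed.

Lemma path_row_insert x r a :
  a \notin r -> x < a -> path ltn x r -> path ltn x (row_insert r a).
Proof.
rewrite /row_insert; elim: r x => /= [|y r IHr] x; first by rewrite andbT.
rewrite inE negb_or neq_ltn => /andP[/orP[lt_ay|lt_ya] a_r] lt_xa /andP[lt_xy srt].
  by rewrite lt_ay /= lt_xa (path_le ltn_trans lt_ay).
by rewrite ltnNge (ltnW lt_ya) /= lt_xy IHr.
Qed.

Lemma sorted_row_insert r a :
  a \notin r -> sorted ltn r -> sorted ltn (row_insert r a).
Proof.
case: r => //= y r; rewrite inE negb_or neq_ltn /row_insert /=.
move=> /andP[/orP[lt_ay|lt_ya] a_r] srt.
  by rewrite lt_ay /= (path_le ltn_trans lt_ay).
by rewrite ltnNge (ltnW lt_ya) /=; apply: path_row_insert.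
Qed.

(* The letter bumped out of column [k] of [r] lands in [u] at some column
   [k' <= k], because the letter of [u] above it, if any, is larger. *)
Lemma dominates_row_insert u r a :
  sorted ltn r -> dominates u r -> find (ltn a) r < size r ->
  dominates (row_insert u (nth 0 r (find (ltn a) r))) (row_insert r a).
Proof.
rewrite /row_insert => srt /dominatesP[le_ur dom]; set k := find _ r => lt_kr.
have lt_ab : a < nth 0 r k by apply: (nth_find 0 (a := ltn a)); rewrite has_find.
set b := nth 0 r k in lt_ab *; set k' := find _ u.
have le_k'k : k' <= k.
  rewrite leqNgt; apply/negP => lt_kk'.
  have lt_ku : k < size u by apply: leq_trans lt_kk' (find_size _ _).
  by have := before_find 0 lt_kk'; rewrite /= dom.
apply/dominatesP; rewrite !size_set_nth; split.
  by rewrite geq_max (maxn_idPr lt_kr) le_ur andbT (leq_ltn_trans le_k'k).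
move=> j lt_j; rewrite !nth_set_nth /=.
(* In column [k'] the new letter [b] lies above [a] if [k' = k], and otherwise above an entry of [r]
   to the left of [b]. *)
have [->|neq_jk'] := eqVneq j k'.
  case: eqVneq => // neq; rewrite (sorted_ltn_nth ltn_trans) ?inE //.
    by rewrite (leq_ltn_trans le_k'k).
  by rewrite ltn_neqAle neq.
have lt_ju : j < size u.
  move: lt_j; rewrite leq_max => /orP[lt_jk'|//].
  by rewrite ltnS in lt_jk'; rewrite (leq_trans _ (find_size (ltn b) u)) // ltn_neqAle neq_jk'.
case: eqVneq lt_ju => [->|_] lt_ju; last exact: dom.
exact: ltn_trans lt_ab (dom _ lt_ju).
Qed.

(** Carries the distinctness hypothesis over to the recursive call of [insert], in the inductions
    below. *)
Lemma uniq_bumped r t a :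
  uniq (a :: flatten (r :: t)) -> ~~ all (gtn a) r ->
  find (ltn a) r < size r /\ uniq (nth 0 r (find (ltn a) r) :: flatten t).
Proof.
rewrite /= mem_cat negb_or cat_uniq => /andP[/andP[a_r _] /and3P[_ r_t t_uniq]] nall.
have lt_kr := find_ltn_size a_r nall; split; rewrite // t_uniq andbT.
apply: contra r_t => b_t; apply/hasP.
by exists (nth 0 r (find (ltn a) r)); rewrite ?mem_nth.
Qed.

Lemma perm_insert t a :
  uniq (a :: flatten t) -> perm_eq (flatten (insert t a).1) (a :: flatten t).
Proof.
elim: t a => [|r t IHt] a //= ua; case: ifP => [_|/negbT nall].
  by rewrite /= cat_rcons -cat1s perm_catCA.
have [lt_kr ub] := uniq_bumped ua nall.
have := IHt _ ub; case: insert => t1 i /= perm_t1.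
have /seq.permP perm_r := perm_set_nth a lt_kr.
apply/seq.permP => P; rewrite count_cat (seq.permP perm_t1 P) /= addnCA addnA.
by have /= -> := perm_r P; rewrite count_cat addnA.
Qed.

Lemma shape_insert t a :
  uniq (a :: flatten t) ->
  shape (insert t a).1 = incr_nth (shape t) (insert t a).2.
Proof.
elim: t a => [|r t IHt] a //= ua; case: ifP => [_|/negbT nall].
  by rewrite /= size_rcons.
have [lt_kr ub] := uniq_bumped ua nall.
have := IHt _ ub; case: insert => t1 i /= ->.
by rewrite size_set_nth (maxn_idPr lt_kr).
Qed.

Lemma shape_add_box t i m : shape (add_box t i m) = incr_nth (shape t) i.
Proof.
rewrite /add_box; elim: t i => [|r t IHt] [|i] //=.
- by elim: i => //= i [->].
- by rewrite size_rcons.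
- by rewrite IHt.
Qed.

Lemma tableau_insert t a :
  uniq (a :: flatten t) -> tableau t -> tableau (insert t a).1.
Proof.
elim: t a => [|r t IHt] a // ua /= /and4P[r_neq0 srt dom tab].
have a_r : a \notin r by move: ua; rewrite /= mem_cat negb_or => /andP[/andP[]].
case: ifP => [lt_ra|/negbT nall] /=.
  rewrite -size_eq0 size_rcons -row_insert_rcons // sorted_row_insert // tab andbT /=.
  by rewrite row_insert_rcons // dominates_rcons.
have [lt_kr ub] := uniq_bumped ua nall.
have := dominates_row_insert srt dom lt_kr; rewrite -head_insert.
have := IHt _ ub tab; case: insert => t1 i /= -> ->.
by rewrite -/(row_insert r a) sorted_row_insert // -size_eq0 size_set_nth -lt0n leq_max.
Qed.

(** The label [m] exceeds all entries, so only the existence of a box below it is at stake; the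
    condition on the new shape provides it. *)
Lemma tableau_add_box t i m :
  tableau t -> all (gtn m) (flatten t) -> sorted geq (incr_nth (shape t) i) ->
  tableau (add_box t i m).
Proof.
rewrite /add_box; elim: t i => [|r t IHt] [|i] //=.
(* A box above an empty row is excluded, as the new shape would not be weakly decreasing. *)
- by move=> _ _; elim: i.
- move=> /and4P[r_neq0 srt dom tab]; rewrite all_cat => /andP[lt_rm _] _.
  have m_r : m \notin r.
    by apply/negP => /(allP lt_rm) /=; rewrite ltnn.
  rewrite -size_eq0 size_rcons -row_insert_rcons // sorted_row_insert // tab andbT /=.
  by rewrite row_insert_rcons // dominates_rcons.
move=> /and4P[-> -> dom tab]; rewrite all_cat => /andP[lt_rm lt_tm] srt_sh /=.
rewrite IHt ?(path_sorted srt_sh) // andbT.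
have /dominatesP[le_ur dom'] := dom.
(* The row just above [r] changes only if it is the one that receives the box. *)
case: i srt_sh => [|i] srt_sh; last by case: (t) dom.
have -> : head [::] (set_nth [::] t 0 (rcons (nth [::] t 0) m)) = rcons (head [::] t) m by case: (t).
apply/dominatesP; rewrite size_rcons.
have lt_ur : size (head [::] t) < size r.
  by case: (t) srt_sh => [|u t'] /= /andP[].
split=> // j; rewrite ltnS leq_eqVlt nth_rcons => /predU1P[->|lt_j].
  by rewrite ltnn eqxx; apply: (allP lt_rm); rewrite mem_nth.
by rewrite lt_j dom'.
Qed.

Lemma rsk_word_rcons w a :
  rsk_word (rcons w a) = rsk_step (rsk_word w) (a, (size w).+1).
Proof.
rewrite /rsk_word size_rcons -[X in iota 1 X]addn1 iotaD add1n /= cats1.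
by rewrite zip_rcons ?size_iota // foldl_rcons.
Qed.

Lemma perm_insertion w : uniq w -> perm_eq (flatten (rsk_word w).1) w.
Proof.
elim/last_ind: w => // w a IHw; rewrite rcons_uniq => /andP[a_w w_uniq].
have perm_w := IHw w_uniq; rewrite rsk_word_rcons /rsk_step /=.
have ua : uniq (a :: flatten (rsk_word w).1).
  by rewrite /= (perm_mem perm_w) (perm_uniq perm_w) a_w.
have := perm_insert ua; case: insert => S i /= perm_S.
by rewrite (perm_trans perm_S) // perm_sym perm_rcons perm_cons perm_sym.
Qed.

(** The insertion tableau leads: being a tableau, it has a partition as its new shape, and the
    recording tableau grows by the same box, as [tableau_add_box] requires. *)
Lemma rsk_word_tableaux w :
  uniq w ->
  [/\ tableau (rsk_word w).1, tableau (rsk_word w).2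
    & shape (rsk_word w).1 = shape (rsk_word w).2].
Proof.
elim/last_ind: w => // w a IHw; rewrite rcons_uniq => /andP[a_w w_uniq].
have [tabS tabT eq_sh] := IHw w_uniq.
have ua : uniq (a :: flatten (rsk_word w).1).
  by have perm_w := perm_insertion w_uniq; rewrite /= (perm_mem perm_w) (perm_uniq perm_w) a_w.
have lt_T : all (gtn (size w).+1) (flatten (rsk_word w).2).
  by rewrite (perm_all _ (perm_recording w)); apply/allP => x; rewrite mem_iota => /andP[].
rewrite rsk_word_rcons /rsk_step /=.
have := tableau_insert ua tabS; have := shape_insert ua.
case: insert => S i /= shS tabS'.
rewrite shape_add_box -eq_sh; split=> //.
by rewrite tableau_add_box // -eq_sh -shS tableau_shape_sorted.
Qed.

(** * The fixed point *)

(** The row superstandard tableau when [m = 1]; it serves as a first standard tableau of shape [la],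
    from which Q_lambda is reached. *)
Fixpoint row_tableau (m : nat) (la : seq nat) : filling :=
  if la is l :: la' then iota m l :: row_tableau (m + l) la' else [::].

Lemma flatten_row_tableau m la : flatten (row_tableau m la) = iota m (sumn la).
Proof. by elim: la m => //= l la IH m; rewrite IH iotaD. Qed.

Lemma shape_row_tableau m la : shape (row_tableau m la) = la.
Proof. by elim: la m => //= l la IH m; rewrite IH size_iota. Qed.

Lemma tableau_row_tableau m la :
  sorted geq la -> all (ltn 0) la -> tableau (row_tableau m la).
Proof.
elim: la m => //= l la IH m srt /andP[l_gt0 la_gt0].
rewrite IH ?(path_sorted srt) // iota_ltn_sorted.
rewrite -size_eq0 size_iota -lt0n l_gt0 andbT /=.
case: la srt {IH la_gt0} => [|k la] /=; first by rewrite dominates0.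
move=> /andP[le_kl _]; apply/dominatesP; rewrite !size_iota; split=> // j lt_jk.
rewrite !nth_iota ?(leq_trans lt_jk) // ltn_add2r -[X in X < _]addn0 ltn_add2l.
by rewrite (leq_trans _ le_kl) // (leq_ltn_trans _ lt_jk).
Qed.

Lemma word_inj n : injective (@word n).
Proof.
move=> s t /eq_in_map eq_st; apply/permP => i; apply: val_inj.
by have [] := eq_st i (mem_enum _ i).
Qed.

Lemma uniq_word n (s : 'S_n) : uniq (word s).
Proof. by rewrite (perm_uniq (word_perm_eq s)) iota_uniq. Qed.

Lemma tableau_RSK n (s : 'S_n) : tableau (RSK s).2.
Proof. by have [] := rsk_word_tableaux (uniq_word s). Qed.

(** One application of [f] moves the recording tableau to the insertion side and puts Q_lambda in
    its place, so [f (f s)] depends only on the shape. *)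
Lemma RSK_f n (s : 'S_n) :
  RSK (f s) = ((RSK s).2, shape_recording (shape (RSK s).2)).
Proof. by rewrite /RSK word_f rsk_reading_word // tableau_RSK. Qed.

Theorem theorem3p8 (n : nat) (hn : 1 <= n) (la : seq nat)
    (hla : is_partition n la) :
  exists! s : 'S_n,
    f s = s /\ shape (RSK s).1 = la /\ shape (RSK s).2 = la.
Proof.
have /and3P[srt_la la_gt0 /eqP sum_la] := hla.
have tab0 := tableau_row_tableau 1 srt_la la_gt0.
have perm0 : perm_eq (reading_word (row_tableau 1 la)) (iota 1 n).
  by rewrite -sum_la -flatten_row_tableau perm_flatten // perm_rev.
pose s0 := perm_of_word perm0.
have RSK_s0 : RSK s0 = (row_tableau 1 la, shape_recording la).
  by rewrite /RSK word_perm_of_word rsk_reading_word // shape_row_tableau.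
have shape_la : shape (shape_recording la) = la.
  have [_ _] := rsk_word_tableaux (uniq_word s0).
  by rewrite -/(RSK s0) RSK_s0 shape_row_tableau.
(* The witness is the reading word of Q_lambda, the recording tableau of [s0]. *)
exists (f s0); split.
  rewrite !RSK_f RSK_s0 /= shape_la; do !split=> //.
  by apply: word_inj; rewrite word_f RSK_f word_f RSK_s0 /= shape_la.
(* For a fixed point, [RSK_f] identifies its own recording tableau with Q_lambda, whose reading word
   it therefore is. *)
move=> s [fix_s [_ shape_s]]; apply: word_inj.
have := RSK_f s; rewrite fix_s shape_s => RSK_s.
by rewrite word_f RSK_s0 -fix_s word_f RSK_s.
Qed.
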